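(* Let $f:\mathbb{R}^n\to(-\infty,+\infty]$ be a closed function that is subdifferentially continuous, let $S=\arg\min f$ be nonempty, and let $\bar x\in S$. Suppose that a set $\mathcal{M}\subset\mathbb{R}^n$ containing $\bar x$ is an identifiable manifold at $\bar x$ for $0\in\hat\partial f(\bar x)$. Then the following are equivalent: (i) (local EB on $(\mathbb{R}^n,d)$) there exist $\epsilon>0,\mu>0$ such that $\mu\,\operatorname{dist}(x,S)\le|\nabla f|(x)$ for all $x\in B_\epsilon(\bar x)$; (ii) (local EB on $(\mathcal{M},d)$) there exist $\epsilon>0,\mu>0$ such that $\mu\,\operatorname{dist}(x,S\cap\mathcal{M})\le|\nabla(f|_{\mathcal{M}})|(x)$ for all $x\in B_\epsilon(\bar x)\cap\mathcal{M}$.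
   Context: $d$ is the Euclidean distance and $B_\epsilon(\bar x)$ the open Euclidean ball. $\hat\partial f$ denotes the Fréchet (regular) subdifferential and $\partial f$ the limiting subdifferential. $x\to_f\bar x$ means $x\to\bar x$ and $f(x)\to f(\bar x)$. $f$ is subdifferentially continuous at $\bar x$ for $\bar v\in\partial f(\bar x)$ if for all sequences $x_k\to\bar x$, $v_k\to\bar v$ with $v_k\in\partial f(x_k)$ one has $f(x_k)\to f(\bar x)$; subdifferentially continuous at $\bar x$ means this holds for every $\bar v\in\partial f(\bar x)$, and ''subdifferentially continuous'' means at every point. Slope: for $x\in\operatorname{dom}f$, $|\nabla f|(x)=0$ if $x$ is a local minimizer of $f$, and otherwise $|\nabla f|(x)=\limsup_{x'\to x,\,x'\neq x}\frac{f(x)-f(x')}{d(x,x')}$. For $x\in\mathcal{M}$, $|\nabla(f|_{\mathcal{M}})|(x)$ is the same quantity for the restriction $f|_{\mathcal{M}}$, i.e. with $x'$ ranging over $\mathcal{M}$ (and $0$ if $x$ is a local minimizer of $f|_{\mathcal M}$). Identifiable manifold: for a closed $f$, $\bar x\in\operatorname{dom}f$ with $0\in\hat\partial f(\bar x)$, a set $\mathcal{M}\ni\bar x$ is an identifiable manifold at $\bar x$ for $0\in\hat\partial f(\bar x)$ if (Sharpness) $\liminf_{x\to_f\bar x,\;x\notin\mathcal{M},\;y\in\partial f(x)}\|y\|>0$, and (Smoothness) $\mathcal{M}$ is a $C^2$-smooth embedded submanifold of $\mathbb{R}^n$ around $\bar x$ and $f|_{\mathcal{M}}$ is $C^2$-smooth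 around $\bar x$ (i.e. locally agrees on $\mathcal M$ with a $C^2$ function on an open set of $\mathbb{R}^n$). *)

(* Defs.v *)
From HB Require Import structures.
From mathcomp Require Import all_boot all_order all_algebra.
From mathcomp Require Import all_classical all_reals all_analysis.
Set Implicit Arguments. Unset Strict Implicit. Unset Printing Implicit Defensive.
Import Order.TTheory GRing.Theory Num.Theory.
Import numFieldNormedType.Exports.
Local Open Scope classical_set_scope.
Local Open Scope ring_scope.

Section Defs.
Variables (R : realType) (n : nat).
Notation V := 'rV[R]_n.

(* Euclidean inner product and norm (the library norm on 'rV is the max norm) *)
Definition edot (u v : V) : R := \sum_(i < n) u ord0 i * v ord0 i.
Definition enorm (u : V) : R := Num.sqrt (edot u u).
Definition edist (x y : V) : R := enorm (x - y).
Definition eball (xb : V) (eps : R) : set V := [set x | edist x xb < eps].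

(* distance to a set, valued in \bar R (+oo for the empty set) *)
Definition setdist (x : V) (S : set V) : \bar R :=
  ereal_inf [set (edist x y)%:E | y in S].

Definition dom (f : V -> \bar R) : set V := [set x | (f x < +oo)%E].

Definition closed_fun (f : V -> \bar R) : Prop :=
  (forall x, f x != -oo%E) /\
  (forall x (a : R), (a%:E < f x)%E -> \forall y \near x, (a%:E < f y)%E).

Definition frechet_subdiff (f : V -> \bar R) (x : V) : set V :=
  [set v | dom f x /\ forall eps : R, 0 < eps ->
     \forall y \near x,
       (f x + (edot v (y - x))%:E - (eps * edist y x)%:E <= f y)%E].

Definition limiting_subdiff (f : V -> \bar R) (x : V) : set V :=
  [set v | dom f x /\ exists (xk vk : nat -> V),
     xk @ \oo --> x /\ (fun k => f (xk k)) @ \oo --> f x /\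
     vk @ \oo --> v /\ forall k, frechet_subdiff f (xk k) (vk k)].

Definition subdiff_continuous_at (f : V -> \bar R) (x v : V) : Prop :=
  forall xk vk : nat -> V, xk @ \oo --> x -> vk @ \oo --> v ->
    (forall k, limiting_subdiff f (xk k) (vk k)) ->
    (fun k => f (xk k)) @ \oo --> f x.

Definition subdiff_continuous (f : V -> \bar R) : Prop :=
  forall x v, limiting_subdiff f x v -> subdiff_continuous_at f x v.

Definition argmin (f : V -> \bar R) : set V :=
  [set x | forall y, (f x <= f y)%E].

Definition local_min_on (A : set V) (f : V -> \bar R) (x : V) : Prop :=
  A x /\ exists2 eps : R, 0 < eps &
    forall y, A y -> edist y x < eps -> (f x <= f y)%E.

Definition slope_on (A : set V) (f : V -> \bar R) (x : V) : \bar R :=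
  if pselect (dom f x) then
    if pselect (local_min_on A f x) then 0%E
    else ereal_inf [set ereal_sup
            [set ((f x - f y) * ((edist x y)^-1)%:E)%E
               | y in [set y | A y /\ y != x /\ edist x y < eps]]
          | eps in [set eps : R | 0 < eps]]
  else +oo%E.

Definition slope (f : V -> \bar R) (x : V) : \bar R := slope_on setT f x.

Definition ebasis (i : 'I_n) : V := delta_mx ord0 i.

Definition C2_on (W : normedModType R) (U : set V) (G : V -> W) : Prop :=
  open U /\
  forall x, U x ->
    {for x, continuous G} /\
    forall i j : 'I_n,
      derivable G x (ebasis i) /\
      {for x, continuous ('D_(ebasis i) G)} /\
      derivable ('D_(ebasis i) G) x (ebasis j) /\
      {for x, continuous ('D_(ebasis j) ('D_(ebasis i) G))}.

Definition C2_submanifold_around (M : set V) (xb : V) : Prop :=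
  exists (m : nat) (U : set V) (F : V -> 'rV[R]_m),
    U xb /\ C2_on U F /\
    (forall x, U x -> forall w : 'rV[R]_m, exists v : V, 'D_v F x = w) /\
    M `&` U = [set x | U x /\ F x = 0].

Definition C2_restriction_around (f : V -> \bar R) (M : set V) (xb : V) : Prop :=
  exists (U : set V) (g : V -> R^o),
    U xb /\ C2_on U g /\ forall x, M x -> U x -> f x = (g x)%:E.

Definition identifiable_manifold (f : V -> \bar R) (M : set V) (xb : V) : Prop :=
  dom f xb /\ frechet_subdiff f xb 0 /\ M xb /\
  (exists2 eta : R, 0 < eta & exists2 delta : R, 0 < delta &
     forall x y, edist x xb < delta -> (`|f x - f xb| < delta%:E)%E ->
       ~ M x -> limiting_subdiff f x y -> eta <= enorm y) /\
  C2_submanifold_around M xb /\ C2_restriction_around f M xb.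

End Defs.

(* Main.v *)
Require Import Defs.
From HB Require Import structures.
From mathcomp Require Import all_boot all_order all_algebra.
From mathcomp Require Import all_classical all_reals all_analysis.
From mathcomp Require Import finmap ring lra.
Set Implicit Arguments.
Unset Strict Implicit.
Import Order.TTheory GRing.Theory Num.Theory.
Import numFieldNormedType.Exports.
Local Open Scope classical_set_scope.
Local Open Scope ring_scope.

(** A point [x] at which [f y >= f x - s |y - x|] locally, with [s] small, lies on
    [M] once it is close to [xb]: minimising [f + k |. - x|^2] near [x] gives
    Fréchet subgradients of norm at most [2 s] at points close to [x],
    subdifferential continuity makes the values of [f] there close to [f xb], and
    sharpness applies because [M] is locally closed.  So small slope, as well as
    minimality, forces [x] on [M], and (ii) => (i) follows because the slope of
    the restriction never exceeds the slope of [f].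

    For (i) => (ii), let [s] exceed the slope of the restriction at [x] in [M].
    Projecting [x + t (y - x)] back on [M = {F = 0}] by metric regularity and
    letting [t] be small gives, uniformly for [x], [y] in [M] near [xb],
    [f y >= f x - C s |y - x| - r |y - x|^2].  A minimiser [z] of
    [f + C s |. - x| + 2 r |. - x|^2] near [x] has small slope, hence lies on [M],
    and the inequality then forces [z = x].  Thus the slope of [f] at [x] is at
    most [C s]. *)

(* [all_analysis] has its own [edist], which shadows the Euclidean distance. *)
Local Notation edist := Defs.edist.

(** * Euclidean norm and lower semicontinuity *)

Section Euclid.
Variables (R : realType) (n : nat).
Notation V := 'rV[R]_n.
Implicit Types u v w x y z : V.

Lemma edotC u v : edot u v = edot v u.
Proof. by apply: eq_bigr => i _; rewrite mulrC. Qed.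

Lemma edotDl u v w : edot (u + v) w = edot u w + edot v w.
Proof. by rewrite -big_split; apply: eq_bigr => i _; rewrite mxE mulrDl. Qed.

Lemma edotZl (a : R) u v : edot (a *: u) v = a * edot u v.
Proof. by rewrite /edot big_distrr; apply: eq_bigr => i _; rewrite mxE /= mulrA. Qed.

Lemma edotDr u v w : edot w (u + v) = edot w u + edot w v.
Proof. by rewrite edotC edotDl !(edotC w). Qed.

Lemma edotZr (a : R) u v : edot v (a *: u) = a * edot v u.
Proof. by rewrite edotC edotZl edotC. Qed.

Lemma edot_ge0 u : 0 <= edot u u.
Proof. by apply: sumr_ge0 => i _; rewrite -expr2 sqr_ge0. Qed.

Lemma enorm_ge0 u : 0 <= enorm u.
Proof. exact: sqrtr_ge0. Qed.

Lemma sqr_enorm u : enorm u ^+ 2 = edot u u.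
Proof. exact: sqr_sqrtr (edot_ge0 u). Qed.

Lemma enormZ (a : R) u : enorm (a *: u) = `|a| * enorm u.
Proof.
by rewrite /enorm edotZl edotZr mulrA -expr2 sqrtrM ?sqr_ge0// sqrtr_sqr.
Qed.

Lemma enormN u : enorm (- u) = enorm u.
Proof. by rewrite -scaleN1r enormZ normrN normr1 mul1r. Qed.

Lemma enorm0 : enorm (0 : V) = 0.
Proof. by rewrite -(scale0r 0) enormZ normr0 mul0r. Qed.

Lemma mx_coord_le m (u : 'rV[R]_m) i : `|u ord0 i| <= `|u|.
Proof.
rewrite [leRHS]/Num.Def.normr/= mx_normrE.
exact: (le_bigmax _ (fun ij : 'I_1 * 'I_m => `|u ij.1 ij.2|) (ord0, i)).
Qed.

Lemma mx_norm_le m (u : 'rV[R]_m) (r : R) :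
  0 <= r -> (forall i, `|u ord0 i| <= r) -> `|u| <= r.
Proof.
move=> r0 ur; rewrite [leLHS]/Num.Def.normr/= mx_normrE.
by apply: bigmax_le => // -[i j] _ /=; rewrite (ord1 i).
Qed.

Lemma enorm_ge u : `|u| <= enorm u.
Proof.
apply: mx_norm_le (enorm_ge0 u) _ => i.
rewrite -sqrtr_sqr; apply: ler_wsqrtr.
rewrite /edot (bigD1 i)//= -expr2 lerDl.
by apply: sumr_ge0 => j _; rewrite -expr2 sqr_ge0.
Qed.

(** The crude factor [n.+1] stays positive for [n = 0], so radii can be divided by it. *)
Lemma enorm_le u : enorm u <= n.+1%:R * `|u|.
Proof.
have r0 : 0 <= n.+1%:R * `|u| by rewrite mulr_ge0.
rewrite -(ger0_norm r0) -sqrtr_sqr; apply: ler_wsqrtr.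
apply: (@le_trans _ _ (\sum_(i < n) `|u| ^+ 2)).
  apply: ler_sum => i _; rewrite -expr2 -(real_normK (num_real _)) ler_sqr ?nnegrE//.
  exact: mx_coord_le.
rewrite sumr_const card_ord -[leLHS]mulr_natl exprMn ler_wpM2r ?sqr_ge0//.
by rewrite -natrX ler_nat (leq_trans (leqnSn n))// leq_pmulr.
Qed.

Lemma enorm_eq0 u : enorm u = 0 -> u = 0.
Proof.
move=> u0; apply/eqP; rewrite -normr_le0; apply: le_trans (enorm_ge u) _.
by rewrite u0.
Qed.

Lemma edot_le u v : edot u v <= enorm u * enorm v.
Proof.
have [/enorm_eq0 ->|u0] := eqVneq (enorm u) 0.
  by rewrite -(scale0r 0) edotZl enormZ normr0 !mul0r.
have [/enorm_eq0 ->|v0] := eqVneq (enorm v) 0.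
  by rewrite -(scale0r 0) edotZr enormZ normr0 !mul0r mulr0.
(* Cauchy-Schwarz: with a = |u| and b = |v|, expanding this square gives 2ab (ab - <u,v>) >= 0. *)
have := edot_ge0 (enorm v *: u + - enorm u *: v).
rewrite edotDl !edotDr !edotZl !edotZr -!sqr_enorm (edotC v u).
have := enorm_ge0 u; have := enorm_ge0 v; rewrite !le0r (negPf u0) (negPf v0)/=.
set a := enorm u; set b := enorm v; set c := edot u v => b0 a0 H.
have ab0 : 0 < a * b by rewrite mulr_gt0.
rewrite -(ler_pM2l ab0); nra.
Qed.

Lemma enormD u v : enorm (u + v) <= enorm u + enorm v.
Proof.
have r0 : 0 <= enorm u + enorm v by rewrite addr_ge0 ?enorm_ge0.
rewrite -(ger0_norm r0) -sqrtr_sqr; apply: ler_wsqrtr.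
rewrite edotDl !edotDr (edotC v u) -!sqr_enorm.
have := edot_le u v; nra.
Qed.

Lemma edistC x y : edist x y = edist y x.
Proof. by rewrite /edist -opprB enormN. Qed.

Lemma edist_triangle y x z : edist x z <= edist x y + edist y z.
Proof.
rewrite /edist (_ : x - z = (x - y) + (y - z)); first exact: enormD.
by rewrite subrKA.
Qed.

Lemma edist_ge0 x y : 0 <= edist x y.
Proof. exact: enorm_ge0. Qed.

Lemma edistxx x : edist x x = 0.
Proof. by rewrite /edist subrr enorm0. Qed.

Lemma edist_gt0 x y : x != y -> 0 < edist x y.
Proof.
rewrite lt0r edist_ge0 andbT; apply: contraNneq => /enorm_eq0/eqP.
by rewrite subr_eq0.
Qed.

(** The topology comes from the max norm; together with [nearP] this passes between its
    neighbourhoods and Euclidean balls. *)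
Lemma near_edist x (d : R) : 0 < d -> \forall y \near x, edist y x < d.
Proof.
move=> d0; apply/nbhs_normP; exists (d / n.+1%:R); first by rewrite /= divr_gt0.
move=> y /=; rewrite distrC lter_pdivlMr// mulrC; exact: le_lt_trans (enorm_le _).
Qed.

Lemma nearP x (P : V -> Prop) : (\forall y \near x, P y) ->
  exists2 d : R, 0 < d & forall y, edist y x < d -> P y.
Proof.
move=> /nbhs_normP[d /= d0 dP]; exists d => // y yx; apply: dP => /=.
by rewrite distrC; apply: le_lt_trans yx; apply: enorm_ge.
Qed.

Lemma compact_box x (r : R) : compact [set y | `|y - x| <= r].
Proof.
apply: bounded_closed_compact.
  exists (r + `|x|); split; first exact: num_real.
  move=> M rM y /= yx; apply/ltW; apply: le_lt_trans rM.
  by rewrite -(subrK x y) (le_trans (ler_normD _ _))// lerD2r.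
have -> : [set y | `|y - x| <= r] = closed_ball_ (fun u : V => `|u|) x r.
  by apply/seteqP; split=> y /=; rewrite distrC.
exact: closed_closed_ball_.
Qed.

End Euclid.

Section LowerSemicontinuity.
Variable R : realType.

(** Without a minimiser the open sets {phi > phi y}, y in [K], cover [K]. The index of a finite
    subcover with the least value of [phi] is a point of [K] that no member contains. *)
Lemma lsc_compact_min (T : ptopologicalType) (K : set T) (phi : T -> \bar R) :
  lower_semicontinuous phi -> (forall x, phi x != -oo%E) -> compact K ->
  K !=set0 -> exists2 z, K z & forall y, K y -> (phi z <= phi y)%E.
Proof.
move=> /lower_semicontinuousP lsc phiN cK [x0 Kx0]; apply: contrapT => H.
have noz z : K z -> exists y, K y /\ (phi y < phi z)%E.
  move=> Kz; apply: contrapT => Hz; apply: H; exists z => // y Ky.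
  by rewrite leNgt; apply/negP => yz; apply: Hz; exists y.
move: cK; rewrite compact_cover => /(_ T K (fun y => [set z | (phi y < phi z)%E])).
case.
- move=> y Ky /=; case E : (phi y) (phiN y) => [a| |] // _.
  rewrite (_ : [set _ | _] = set0); first exact: open0.
  by rewrite -subset0 => z /=; rewrite ltNge leey.
- by move=> z /noz[y [Ky yz]]; exists y.
move=> D DK KD.
have min (s : seq T) : s != [::] ->
    exists2 x, x \in s & forall y, y \in s -> (phi x <= phi y)%E.
  elim: s => // a s IH _; have [->|/IH[x xs xmin]] := eqVneq s [::].
    by exists a; rewrite ?inE// => y; rewrite inE => /eqP ->.
  have [ax|xa] := leP (phi a) (phi x).
    exists a; rewrite ?mem_head// => y; rewrite inE => /predU1P[->//|/xmin].
    exact: le_trans.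
  exists x; rewrite ?inE ?xs ?orbT// => y; rewrite inE => /predU1P[->|/xmin//].
  exact: ltW.
have D0 : (enum_fset D) != [::].
  by have [y yD _] := KD _ Kx0; apply/eqP => D0; move: (yD : y \in enum_fset D); rewrite D0.
have [x xD xmin] := min _ D0.
have Kx : K x by apply: set_mem; exact: DK.
have [y yD /= yx] := KD _ Kx.
by have := lt_le_trans yx (xmin _ yD); rewrite ltxx.
Qed.

Lemma lscD_cont (T : topologicalType) (f : T -> \bar R) (h : T -> R) :
  lower_semicontinuous f -> (forall x, f x != -oo%E) -> continuous h ->
  lower_semicontinuous (fun x => f x + (h x)%:E)%E.
Proof.
move=> lsc fN ch x a afh.
have [e e0 aef] : exists2 e : R, 0 < e & ((a - h x + e)%:E < f x)%E.
  case: (f x) (fN x) afh => [b| |]// _.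
  - rewrite -EFinD lte_fin => ab; exists ((b + h x - a) / 2); first lra.
    by rewrite lte_fin; lra.
  - by exists 1 => //; rewrite ltry.
have [U Ux Uf] := lsc _ _ aef.
have Hx : \forall y \near x, h x - e < h y.
  have : \forall y \near x, `|h x - h y| < e by apply: cvgr_dist_lt (ch x) _ e0.
  apply: filterS => y; rewrite ltr_norml => /andP[_]; lra.
exists (U `&` [set y | h x - e < h y]); first exact: filterI.
move=> y [/Uf Ufy /= hy]; case: (f y) (fN y) Ufy => [b| |]//= _.
- by rewrite !lte_fin; lra.
- by rewrite !ltry.
Qed.

End LowerSemicontinuity.

(** * Subgradients and slopes *)

Section Subgradients.
Variables (R : realType) (n : nat).
Notation V := 'rV[R]_n.
Implicit Types (f : V -> \bar R) (x y z : V) (a s : R).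

Lemma continuous_edist x : continuous (fun y : V => edist y x : R^o).
Proof.
move=> y; apply/(@cvgrPdist_lt _ _ _ (nbhs y)) => e e0; near=> z.
have zy : edist z y < e by near: z; exact: near_edist.
apply: le_lt_trans zy; rewrite ler_norml.
have := edist_triangle y z x; have := edist_triangle z y x.
rewrite (edistC y z); lra.
Unshelve. all: by end_near. Qed.

(** Minimality of [z] is stated with [f y] isolated, so that it makes sense where [f y] is infinite;
    the value at [z] is finite because [x] itself competes. *)
Lemma penalized_min f x a (c k r : R) : closed_fun f -> f x = a%:E -> 0 <= r ->
  exists z b, [/\ `|z - x| <= r, f z = b%:E & forall y, `|y - x| <= r ->
    ((b + c * edist z x + k * edist z x ^+ 2 -
      (c * edist y x + k * edist y x ^+ 2))%:E <= f y)%E].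
Proof.
move=> [fN lsc] fx r0.
pose h (y : V) : R := c * edist y x + k * edist y x ^+ 2.
have ch : continuous h.
  move=> y; apply: (@cvgD _ _ _ (nbhs y)); apply: (@cvgM _ _ (nbhs y)).
  - exact: cvg_cst.
  - exact: continuous_edist.
  - exact: cvg_cst.
  - by apply: (@cvgM _ _ (nbhs y)); exact: continuous_edist.
have lscf : lower_semicontinuous f.
  by move=> y b /lsc H; exists [set y | (b%:E < f y)%E].
have hN y : (f y + (h y)%:E)%E != -oo%E by case: (f y) (fN y).
have [] := lsc_compact_min (lscD_cont lscf fN ch) hN (@compact_box R n x r).
  by exists x; rewrite /= subrr normr0.
move=> z /= zr zmin.
have [b fz] : exists b, f z = b%:E.
  have := zmin x; rewrite /= subrr normr0 => /(_ r0); rewrite fx.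
  by case: (f z) (fN z) => [b| |]//= _ _; exists b.
exists z, b; split=> // y /zmin; rewrite fz; case: (f y) (fN y) => [d| |]//= _.
- rewrite !lee_fin /h; lra.
- by move=> _; rewrite leey.
Qed.

Lemma sqr_edist x y z :
  edist y x ^+ 2 = edist z x ^+ 2 + 2 * edot (z - x) (y - z) + edist y z ^+ 2.
Proof.
have -> : edist y x = enorm ((z - x) + (y - z)) by rewrite addrC subrKA.
rewrite /edist; move: (z - x) (y - z) => u v.
by rewrite !sqr_enorm edotDl !edotDr (edotC v u); ring.
Qed.

(* Minimising [f + k |. - x|^2] near [x] for large [k] yields the subgradient
   [- 2 k (z - x)] at the minimiser [z]. *)
Lemma frechet_approx f x a s (e : R) : closed_fun f -> f x = a%:E -> 0 < s ->
  (\forall y \near x, ((a - s * edist y x)%:E <= f y)%E) -> 0 < e ->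
  exists y b v, [/\ edist y x < e, f y = b%:E, `|b - a| < e,
    frechet_subdiff f y v & enorm v <= 2 * s].
Proof.
move=> cf fx s0 /nearP[d d0 fd] e0.
pose r := Num.min d e / (2 * n.+1%:R).
have r0 : 0 < r by rewrite divr_gt0// ?mulr_gt0// lt_min d0.
have rd y : `|y - x| <= r -> edist y x < d.
  move=> yr; apply: le_lt_trans (enorm_le (y - x)) _.
  apply: (@le_lt_trans _ _ (n.+1%:R * r)); first by rewrite ler_wpM2l.
  rewrite /r mulrC invfM mulrA divfK ?pnatr_eq0//.
  rewrite ltr_pdivrMr// (@le_lt_trans _ _ d) ?ge_min ?lexx//; lra.
pose t := Num.min (r / 2) (Num.min (e / 2) (e / (2 * s))).
have t0 : 0 < t by rewrite !lt_min; apply/and3P; split; apply: divr_gt0 => //; apply: mulr_gt0.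
have [tr te ts] : [/\ t < r, t < e & s * t < e].
  have tr : t <= r / 2 by rewrite ge_min lexx.
  have te : t <= e / 2 by rewrite !ge_min lexx ?orbT.
  have ts : t <= e / (2 * s) by rewrite !ge_min lexx ?orbT.
  split; try lra.
  move: ts; rewrite ler_pdivlMr ?mulr_gt0//; lra.
(* Comparing [z] with [x] gives k |z - x|^2 <= a - b <= s |z - x|. As k t = s, this means |z - x| <=
   t, and the subgradient has norm 2 k |z - x| <= 2 s. *)
pose k := s / t.
have k0 : 0 < k by rewrite divr_gt0.
have kt : k * t = s by rewrite /k divfK// gt_eqF.
have [z [b [zr fz zmin]]] := @penalized_min f x a 0 k r cf fx (ltW r0).
have := zmin x; rewrite subrr normr0 fx edistxx lee_fin => /(_ (ltW r0)) zx.
have := fd z (rd z zr); rewrite fz lee_fin => sz.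
have ez0 := edist_ge0 z x.
have ezt : edist z x <= t.
  rewrite leNgt; apply/negP => tz.
  have : k * t * edist z x < k * edist z x ^+ 2.
    by rewrite -mulrA ltr_pM2l// expr2 ltr_pM2r// (lt_trans t0).
  by rewrite kt; nra.
exists z, b, (- (2 * k) *: (z - x)); split => //.
- exact: le_lt_trans ezt te.
- have : s * edist z x <= s * t by rewrite ler_pM2l.
  have : 0 <= k * edist z x ^+ 2 by rewrite mulr_ge0 ?sqr_ge0// ltW.
  rewrite ltr_norml; lra.
- split; first by rewrite /dom /= fz ltry.
  move=> ep ep0.
  (* Since |z - x| <= t, points within [r - t] of [z] stay in the box; within [ep / k] the remainder
     k |y - z|^2 is at most ep |y - z|. *)
  have rz : 0 < r - t by lra.
  have ek0 : 0 < ep / k by rewrite divr_gt0.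
  near=> y.
  have yz1 : edist y z < r - t by near: y; exact: near_edist.
  have yz2 : edist y z < ep / k by near: y; exact: near_edist.
  have yr : `|y - x| <= r.
    apply: le_trans (enorm_ge _) _; have := edist_triangle z y x.
    rewrite -!/(edist _ _); lra.
  apply: le_trans (zmin y yr); rewrite fz lee_fin edotZl (sqr_edist x y z).
  have : k * edist y z ^+ 2 <= ep * edist y z.
    by rewrite expr2 mulrA ler_wpM2r ?edist_ge0// mulrC -ler_pdivlMr// ltW.
  lra.
- rewrite enormZ normrN ger0_norm; last by rewrite mulr_ge0// ltW.
  rewrite -/(edist z x) -kt; nra.
Unshelve. all: by end_near. Qed.

Lemma frechet_limiting f x v : frechet_subdiff f x v -> limiting_subdiff f x v.
Proof.
move=> fv; split; first by case: fv.
by exists (fun=> x), (fun=> v); do ?split => //; exact: cvg_cst.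
Qed.

Lemma cvg_edist (u : nat -> V) x :
  (forall k, edist (u k) x < k.+1%:R^-1) -> u @ \oo --> x.
Proof.
move=> ux; apply/cvgrPdist_lt => e e0.
have := near_infty_natSinv_lt (PosNum e0); apply: filterS => k /= ke.
rewrite distrC; apply: le_lt_trans (enorm_ge _) _.
exact: lt_trans (ux k) ke.
Qed.

(** If no [e] worked, the choices e = 1/(k+1) would give sequences x_k -> xb and v_k -> 0
    contradicting subdifferential continuity at [xb] for 0. *)
Lemma small_subgradient_value f xb (d : R) : (forall x, f x != -oo%E) ->
  subdiff_continuous f -> frechet_subdiff f xb 0 -> 0 < d ->
  exists2 e : R, 0 < e & forall x v, edist x xb < e -> frechet_subdiff f x v ->
    enorm v < e -> (`|f x - f xb| < d%:E)%E.
Proof.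
move=> fN sc f0 d0; apply: contrapT => H.
have noe (k : nat) : exists xv : V * V, [/\ edist xv.1 xb < k.+1%:R^-1,
    frechet_subdiff f xv.1 xv.2, enorm xv.2 < k.+1%:R^-1 &
    ~ (`|f xv.1 - f xb| < d%:E)%E].
  apply: contrapT => Hk; apply: H; exists k.+1%:R^-1; first by rewrite invr_gt0.
  move=> x v xk fv vk; apply: contrapT => xd; apply: Hk.
  by exists (x, v).
have [u uP] := choice noe.
have cv : (fun k => f (u k).1) @ \oo --> f xb.
  apply: (sc xb 0 (frechet_limiting f0) (fst \o u) (snd \o u)).
  - by apply: cvg_edist => k; case: (uP k).
  - by apply: cvg_edist => k; rewrite /edist subr0; case: (uP k).
  - by move=> k; apply: frechet_limiting; case: (uP k).
have fbfin : f xb \is a fin_num.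
  by case: f0 => + _; rewrite /dom /= fin_numE fN/= => /lt_eqF ->.
have : \forall k \near \oo, (`|f (u k).1 - f xb| < d%:E)%E.
  have : \forall t \near f xb, (`|t - f xb| < d%:E)%E.
    rewrite -(fineK fbfin); apply/nbhs_EFin => /=.
    have : \forall t \near fine (f xb), `|fine (f xb) - t| < d.
      by apply/nbhs_normP; exists d.
    by apply: filterS => t /=; rewrite lte_fin distrC.
  exact: cv.
case=> N _ /(_ N (leqnn N)); case: (uP N) => _ _ _ nd; exact: nd.
Qed.

Lemma small_slope_mem f (M : set V) xb (d eta del : R) : closed_fun f ->
  subdiff_continuous f -> frechet_subdiff f xb 0 -> 0 < d -> 0 < eta -> 0 < del ->
  (forall x, edist x xb < d -> ~ M x -> \forall y \near x, ~ M y) ->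
  (forall x y, edist x xb < del -> (`|f x - f xb| < del%:E)%E ->
       ~ M x -> limiting_subdiff f x y -> eta <= enorm y) ->
  exists e s, [/\ 0 < e, 0 < s & forall x a, edist x xb < e -> f x = a%:E ->
    (\forall y \near x, ((a - s * edist y x)%:E <= f y)%E) -> M x].
Proof.
move=> cf sc f0 d0 eta0 del0 Mcl sharp.
have [e1 e10 vale1] := small_subgradient_value cf.1 sc f0 del0.
(* A point within [e] of [x] is within [2 * e] of [xb]; the 4 makes the subgradient bound [2 * s]
   strictly smaller than [eta] and [e1]. *)
pose e := Num.min d (Num.min del e1) / 2; pose s := Num.min eta e1 / 4.
have e0 : 0 < e by rewrite divr_gt0// !lt_min d0 del0.
have s0 : 0 < s by rewrite divr_gt0// lt_min eta0.
have [ed edel ee1] : [/\ 2 * e <= d, 2 * e <= del & 2 * e <= e1].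
  by rewrite /e mulrC divfK ?pnatr_eq0//; split; rewrite !ge_min lexx ?orbT.
have [seta se1] : 2 * s < eta /\ 2 * s < e1.
  have h1 : s * 4 <= eta by rewrite divfK ?pnatr_eq0// ge_min lexx.
  have h2 : s * 4 <= e1 by rewrite divfK ?pnatr_eq0// ge_min lexx orbT.
  by split; lra.
exists e, s; split=> // x a xe fx xs; apply: contrapT => nM.
have /nearP[r r0 rM] := Mcl x (lt_le_trans xe (ltac:(lra) : e <= d)) nM.
have re0 : 0 < Num.min r e by rewrite lt_min r0.
have [y [b [v [yx fy _ yv vs]]]] := @frechet_approx f x a s _ cf fx s0 xs re0.
move: yx; rewrite lt_min => /andP[yr ye].
have yxb : edist y xb < 2 * e by have := edist_triangle x y xb; lra.
have := sharp y v _ _ (rM y yr) (frechet_limiting yv).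
have yd : edist y xb < del by lra.
have := vale1 y v (lt_le_trans yxb ee1) yv (le_lt_trans vs se1).
by move=> h /(_ yd h); lra.
Qed.

(** With [slope_le] this trades the limsup for a local lower bound. At a local minimiser the bound
    holds without any loss, and the value +oo outside the domain makes [f x] finite here. *)
Lemma slope_lt f (A : set V) x s : (forall y, f y != -oo%E) -> 0 < s ->
  (slope_on A f x < s%:E)%E -> exists2 a, f x = a%:E &
    \forall y \near x, A y -> ((a - s * edist y x)%:E <= f y)%E.
Proof.
move=> fN s0; rewrite /slope_on.
case: (pselect (dom f x)) => [fd|fd] /=; last by rewrite ltNge leey.
move: fd.
rewrite /dom /=; case fx : (f x) (fN x) => [a| |]// _ _.
case: pselect => [lm _|lm H]; exists a => //.
  case: lm => Ax [e e0 emin].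
  have := near_edist x e0; apply: filterS => y yx Ay.
  apply: le_trans (emin y Ay yx); rewrite fx lee_fin gerBl.
  by rewrite mulr_ge0 ?edist_ge0// ltW.
case/ereal_inf_lt: H => _ [e /= e0 <-] sups.
have := near_edist x e0; apply: filterS => y yx Ay.
have [->|yNx] := eqVneq y x; first by rewrite fx edistxx mulr0 subr0.
have xy0 : 0 < edist x y by rewrite edist_gt0// eq_sym.
have : ((a%:E - f y) * (edist x y)^-1%:E < s%:E)%E.
  by apply: le_lt_trans sups; apply: ereal_sup_ubound; exists y => //=; rewrite edistC.
case: (f y) (fN y) => [b| |]// _; last by rewrite leey.
rewrite /= lte_fin ltr_pdivrMr// lee_fin (edistC y x); lra.
Qed.

Lemma slope_le f (A : set V) x a s : f x = a%:E -> 0 <= s ->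
  (\forall y \near x, A y -> ((a - s * edist y x)%:E <= f y)%E) ->
  (slope_on A f x <= s%:E)%E.
Proof.
move=> fx s0 /nearP[d d0 H]; rewrite /slope_on.
case: (pselect (dom f x)) => [fd|[]] /=; last by rewrite /dom /= fx ltry.
case: pselect => lm /=; first by rewrite lee_fin.
apply: (@le_trans _ _ (ereal_sup [set ((f x - f y) * (edist x y)^-1%:E)%E
  | y in [set y | A y /\ y != x /\ edist x y < d]])).
  by apply: ereal_inf_lbound; exists d.
apply: ub_ereal_sup => _ [y /= [Ay [yNx xyd]] <-]; rewrite fx.
have xy0 : 0 < edist x y by rewrite edist_gt0// eq_sym.
have := H y; rewrite edistC => /(_ xyd Ay).
case: (f y) => [b| |]//=.
- rewrite !lee_fin ler_pdivrMr//; lra.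
(* Where [f y] is +oo the quotient is -oo. *)
- by rewrite mulNyr gtr0_sg ?invr_gt0// mul1e leNye.
Qed.

End Subgradients.

(** * Taylor expansion of C2 maps *)

Section Calculus.
Variables (R : realType) (n : nat).
Notation V := 'rV[R]_n.
Implicit Types (x y z p v : V).

(** Unordered, since the coordinates of two points may compare either way. *)
Definition between (a b c : R) := Num.min a b <= c <= Num.max a b.

Lemma mvt_between (f df : R -> R^o) (a b : R) :
  (forall s, between a b s -> is_derive s (1 : R) f (df s)) ->
  exists2 c, between a b c & f b - f a = df c * (b - a).
Proof.
rewrite /between; wlog ab : a b / a <= b.
  move=> H; case/orP: (le_total a b) => [ab|ba]; first exact: H.
  rewrite minC maxC => df'; have [c cab E] := H _ _ ba df'.
  exists c => //.
  by rewrite -(opprB (f a)) E -mulrN opprB.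
rewrite (min_idPl ab) (max_idPr ab) => fdf.
have [||c] := @MVT_segment _ f df a b ab.
- by move=> s; rewrite in_itv /= => /andP[/ltW ? /ltW ?]; apply: fdf; apply/andP.
- apply: derivable_within_continuous => s; rewrite in_itv /= => /fdf sd.
  exact: ex_derive.
- by rewrite in_itv /= => cab E; exists c.
Qed.

Lemma is_derive_line (h : V -> R^o) x v (s : R) (l : R^o) :
  is_derive (x + s *: v) v h l -> is_derive s (1 : R) (fun s => h (x + s *: v)) l.
Proof.
have E : (fun t : R => t^-1 *: (h (t *: v + (x + s *: v)) - h (x + s *: v))) =
   (fun t : R => t^-1 *: (h (x + (t *: (1 : R) + s) *: v) - h (x + s *: v))).
  apply/funext => t; congr (_ *: (h _ - _)).
  have -> : t *: (1 : R) = t by exact: mulr1.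
  by rewrite scalerDl addrCA.
case; rewrite /derivable /derive E => d1 d2.
by split; rewrite /derivable /derive.
Qed.

Lemma norm_between (a b c d r : R) : between a b c -> `|a - d| <= r ->
  `|b - d| <= r -> `|c - d| <= r.
Proof.
rewrite /between !ler_norml; case: (leP a b) => ab /andP[? ?] /andP[? ?] /andP[? ?];
  apply/andP; split; lra.
Qed.

(** Moving from [x] to [y] one coordinate at a time reduces to the mean value theorem in one
    variable. Intermediate points have their coordinates between those of [x] and [y], hence stay in
    every max-norm ball containing both. *)
Lemma partials_mvt (h : V -> R^o) (D : 'I_n -> V -> R^o) (c : V) (r : R) :
  (forall x, `|x - c| < r -> forall i, is_derive x (ebasis R i) h (D i x)) ->
  forall x y, `|x - c| < r -> `|y - c| < r ->
  exists xi : 'I_n -> V, (forall i, `|xi i - c| < r /\ `|xi i - x| <= `|y - x|) /\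
    h y - h x = \sum_(i < n) D i (xi i) * (y - x) ord0 i.
Proof.
move=> hD x y xr yr.
(* The corners run from z 0 = x to z n = y; below, [p i] parametrises the edge from [z i] to
   [z i.+1]. *)
pose z (k : nat) : V := \row_j (if (j < k)%N then y ord0 j else x ord0 j).
have zx : z 0%N = x by apply/rowP => j; rewrite mxE.
have zy : z n = y by apply/rowP => j; rewrite mxE ltn_ord.
pose p (i : 'I_n) (s : R) : V := z i + (s - x ord0 i) *: ebasis R i.
have pE i s j : p i s ord0 j = if (j < i)%N then y ord0 j else
    if j == i then s else x ord0 j.
  rewrite !mxE eqxx /=; have [->|ji] := eqVneq j i.
    by rewrite ltnn mulr1 addrC subrK.
  by rewrite mulr0 addr0.
have pb i s : between (x ord0 i) (y ord0 i) s ->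
    forall j, between (x ord0 j) (y ord0 j) (p i s ord0 j).
  move=> sb j; rewrite pE; case: ifP => _; last case: eqVneq => [->//|_].
    by rewrite /between ge_min le_max !lexx !orbT.
  by rewrite /between ge_min le_max !lexx.
have pr i s : between (x ord0 i) (y ord0 i) s ->
    `|p i s - c| < r /\ `|p i s - x| <= `|y - x|.
  move=> sb; split.
    apply: (@le_lt_trans _ _ (Num.max `|x - c| `|y - c|)); last by rewrite gt_max xr.
    apply: mx_norm_le; first by rewrite le_max normr_ge0.
    move=> j; rewrite mxE [in X in _ + X]mxE.
    apply: (norm_between (pb _ _ sb j)); rewrite le_max; apply/orP; [left|right].
      by have := mx_coord_le (x - c) j; rewrite !mxE.
    by have := mx_coord_le (y - c) j; rewrite !mxE.
  apply: mx_norm_le => // j; rewrite mxE [in X in _ + X]mxE.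
  apply: (norm_between (pb _ _ sb j)); first by rewrite subrr normr0.
  by have := mx_coord_le (y - x) j; rewrite !mxE.
have step (i : 'I_n) : exists q : V, (`|q - c| < r /\ `|q - x| <= `|y - x|) /\
    h (z i.+1) - h (z i) = D i q * (y - x) ord0 i.
  have [|s sb E] := @mvt_between (fun s => h (p i s)) (fun s => D i (p i s))
     (x ord0 i) (y ord0 i).
    move=> s sb; have [ps _] := pr i s sb.
    have := hD _ ps i.
    pose w := z i - x ord0 i *: ebasis R i.
    have pw t : p i t = w + t *: ebasis R i by rewrite /p /w scalerBl addrAC -addrA.
    rewrite pw (_ : (fun s => h (p i s)) = (fun s => h (w + s *: ebasis R i))).
      exact: is_derive_line.
    by apply/funext => t; rewrite pw.
  exists (p i s); split; first exact: pr.
  have <- : p i (x ord0 i) = z i by rewrite /p subrr scale0r addr0.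
  have <- : p i (y ord0 i) = z i.+1.
    apply/rowP => j; rewrite pE mxE ltnS.
    case: ltngtP => [//|ij|/val_inj ->]; last by rewrite eqxx.
    by case: eqVneq ij => [->|//]; rewrite ltnn.
  by rewrite E !mxE.
have [xi xiP] := choice step.
exists xi; split; first by move=> i; case: (xiP i).
rewrite -[in LHS]zx -[in LHS]zy -(telescope_sumr (fun k => h (z k)) (leq0n n)).
by rewrite big_mkord; apply: eq_bigr => i _; case: (xiP i).
Qed.


Lemma sum_coord_le m (a b : 'I_m -> R) (A B : R) :
  (forall i, `|a i| <= A) -> (forall i, `|b i| <= B) ->
  `|\sum_(i < m) a i * b i| <= m%:R * A * B.
Proof.
move=> aA bB; apply: le_trans (ler_norm_sum _ _ _) _.
apply: (@le_trans _ _ (\sum_(i < m) A * B)).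
  by apply: ler_sum => i _; rewrite normrM ler_pM.
by rewrite sumr_const card_ord -[leLHS]mulr_natl mulrA.
Qed.

Lemma ler_sum_term m (a : 'I_m -> R) i : (forall i, 0 <= a i) ->
  a i <= \sum_(i < m) a i.
Proof.
by move=> a0; rewrite (bigD1 i)//= lerDl; apply: sumr_ge0 => j _; exact: a0.
Qed.

(** The mean value formula for [D i] makes the partials Lipschitz. For [h] it writes the remainder
    as the sum of (D i (xi i) - D i x) (y - x)_i with each [xi i] within |y - x| of [x]. *)
Lemma taylor_scalar (h : V -> R^o) (D : 'I_n -> V -> R^o)
    (D2 : 'I_n -> 'I_n -> V -> R^o) (c : V) (r L : R) :
  (forall x, `|x - c| < r -> forall i, is_derive x (ebasis R i) h (D i x)) ->
  (forall x, `|x - c| < r -> forall i j, is_derive x (ebasis R j) (D i) (D2 i j x)) ->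
  (forall x, `|x - c| < r -> forall i, `|D i x| <= L) ->
  (forall x, `|x - c| < r -> forall i j, `|D2 i j x| <= L) ->
  forall x y, `|x - c| < r -> `|y - c| < r ->
  [/\ forall i, `|D i y - D i x| <= n%:R * L * `|y - x|,
      `|h y - h x| <= n%:R * L * `|y - x| &
      `|h y - h x - \sum_(i < n) D i x * (y - x) ord0 i| <=
        n%:R * (n%:R * L * `|y - x|) * `|y - x|].
Proof.
move=> hD hD2 DL D2L x y xr yr.
have lipD i z : `|z - c| < r -> `|D i z - D i x| <= n%:R * L * `|z - x|.
  move=> zr.
  have [xi [xiP ->]] := partials_mvt (fun p pr => hD2 p pr i) xr zr.
  apply: sum_coord_le => j; last exact: mx_coord_le.
  by have [jr _] := xiP j; exact: D2L.
have [xi [xiP E]] := partials_mvt hD xr yr.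
split; first by move=> i; exact: lipD.
  rewrite E; apply: sum_coord_le => j; last exact: mx_coord_le.
  by have [jr _] := xiP j; exact: DL.
rewrite E -sumrB; under eq_bigr do rewrite -mulrBl.
apply: sum_coord_le => j; last exact: mx_coord_le.
have [jr jx] := xiP j; apply: le_trans (lipD j _ jr) _.
rewrite ler_wpM2l// mulr_ge0// (le_trans _ (DL x xr j))//.
Qed.

Lemma near_coords m (c : 'rV[R]_m) (P : 'rV[R]_m -> Prop) :
  (\forall x \near c, P x) -> exists2 r : R, 0 < r & forall x : 'rV_m, `|x - c| < r -> P x.
Proof.
move=> /nbhs_normP[r /= r0 rP]; exists r => // x xc; apply: rP => /=.
by rewrite distrC.
Qed.

Lemma continuous_near_dist (W : normedModType R) (H : V -> W) x (e : R) :
  {for x, continuous H} -> 0 < e -> \forall y \near x, `|H x - H y| < e.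
Proof.
move=> Hc e0; have {}Hc : H @ x --> H x by exact: Hc.
by apply: cvgr_dist_lt Hc _ _.
Qed.

Lemma C2_bounds (W : normedModType R) (U : set V) (G : V -> W) (c : V) :
  C2_on U G -> U c -> exists r L : R, [/\ 0 < r, 0 <= L &
    forall x, `|x - c| < r -> U x /\ forall i, `|'D_(ebasis R i) G x| <= L /\
      forall j, `|'D_(ebasis R j) ('D_(ebasis R i) G) x| <= L].
Proof.
move=> [oU UG] Uc; have [_ Gc] := UG c Uc.
(* Summing over all indices dominates every single bound; each 1 leaves room for variation near
   [c]. *)
pose L := \sum_(i < n) (`|'D_(ebasis R i) G c| + 1 +
  \sum_(j < n) (`|'D_(ebasis R j) ('D_(ebasis R i) G) c| + 1)).
have near1 (H : V -> W) : {for c, continuous H} ->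
    \forall x \near c, `|H x| <= `|H c| + 1.
  move=> Hc; have := continuous_near_dist Hc ltr01.
  apply: filterS => x Hx; have := ler_normD (H c) (H x - H c).
  rewrite addrC subrK -(distrC (H c)); lra.
have Gij i j : \forall x \near c, `|'D_(ebasis R j) ('D_(ebasis R i) G) x| <=
    `|'D_(ebasis R j) ('D_(ebasis R i) G) c| + 1.
  by apply: near1; have [_ [_ [_ ]]] := Gc i j.
have Gi i : \forall x \near c, `|'D_(ebasis R i) G x| <= `|'D_(ebasis R i) G c| + 1.
  by apply: near1; have [_ []] := Gc i i.
have [r r0 rP] := near_coords (filterI (open_nbhs_nbhs (conj oU Uc))
  (filter_forall _ (fun i => filterI (Gi i) (filter_forall _ (Gij i))))).
have S0 i : 0 <= \sum_(j < n) (`|'D_(ebasis R j) ('D_(ebasis R i) G) c| + 1).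
  by apply: sumr_ge0 => j _; rewrite addr_ge0.
have T0 i : 0 <= `|'D_(ebasis R i) G c| + 1 +
    \sum_(j < n) (`|'D_(ebasis R j) ('D_(ebasis R i) G) c| + 1).
  by rewrite addr_ge0// addr_ge0.
exists r, L; split => //; first by apply: sumr_ge0 => i _; exact: T0.
move=> x /rP[Ux H]; split=> // i; have [H1 H2] := H i.
have := @ler_sum_term _ _ i T0; rewrite -/L => TL; split=> [|j].
  by apply: le_trans H1 (le_trans _ TL); rewrite lerDl.
apply: le_trans (H2 j) (le_trans _ TL).
apply: (@le_trans _ _ (\sum_(j < n) (`|'D_(ebasis R j) ('D_(ebasis R i) G) c| + 1))).
  by apply: (@ler_sum_term _ _ j) => k; rewrite addr_ge0.
by rewrite lerDr addr_ge0.
Qed.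

(** Built from partial derivatives, hence linear in [v] by construction; [derive_jac] identifies it
    with the directional derivative where the remainder is quadratic. *)
Definition jac m (F : V -> 'rV[R]_m) (x v : V) : 'rV[R]_m :=
  \sum_(i < n) v ord0 i *: 'D_(ebasis R i) F x.

Lemma jacZ m (F : V -> 'rV[R]_m) x v (t : R) : jac F x (t *: v) = t *: jac F x v.
Proof. by rewrite /jac scaler_sumr; apply: eq_bigr => i _; rewrite mxE scalerA. Qed.

Lemma is_derive_coord m (F : V -> 'rV[R]_m) x v k : derivable F x v ->
  is_derive x v (fun y => F y ord0 k : R^o) ('D_v F x ord0 k).
Proof.
move=> dF; split; first by have /derivable_mxP/(_ ord0 k) := dF.
by rewrite derive_mx// mxE.
Qed.

(** In the max norm the bounds of [taylor_scalar] on the coordinates pass to the vector unchanged;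
    the factor (n+1)^2 covers both n and n^2. *)
Lemma C2_taylor m (U : set V) (F : V -> 'rV[R]_m) (c : V) :
  C2_on U F -> U c -> exists r L : R, [/\ 0 < r, 0 <= L,
    forall x, `|x - c| < r -> U x & forall x y, `|x - c| < r -> `|y - c| < r ->
    [/\ `|F y - F x| <= L * `|y - x|,
        `|F y - F x - jac F x (y - x)| <= L * `|y - x| ^+ 2 &
        forall v, `|jac F y v - jac F x v| <= L * `|y - x| * `|v|]].
Proof.
move=> C2F Uc; have [r [L [r0 L0 H]]] := C2_bounds C2F Uc.
have [_ UF] := C2F.
have N1 : 1 <= n.+1%:R :> R by rewrite ler1n.
have nN : n%:R <= n.+1%:R :> R by rewrite ler_nat.
have L2 : n%:R * L <= n.+1%:R ^+ 2 * L.
  by rewrite ler_wpM2r// expr2 (le_trans nN)// ler_peMr.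
exists r, (n.+1%:R ^+ 2 * L); split=> //; first by rewrite mulr_ge0// sqr_ge0.
  by move=> x /H[].
move=> x y xr yr.
have T k := @taylor_scalar (fun z => F z ord0 k)
  (fun i z => 'D_(ebasis R i) F z ord0 k)
  (fun i j z => 'D_(ebasis R j) ('D_(ebasis R i) F) z ord0 k) c r L.
have {}T k : [/\ forall i, `|'D_(ebasis R i) F y ord0 k - 'D_(ebasis R i) F x ord0 k|
    <= n%:R * L * `|y - x|, `|F y ord0 k - F x ord0 k| <= n%:R * L * `|y - x| &
      `|F y ord0 k - F x ord0 k - \sum_(i < n) 'D_(ebasis R i) F x ord0 k * (y - x) ord0 i| <=
        n%:R * (n%:R * L * `|y - x|) * `|y - x|].
  apply: T => // z zr i.
  - have [/UF[_ /(_ i i)[dF _]] _] := H z zr; exact: is_derive_coord.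
  - move=> j; have [/UF[_ /(_ i j)[_ [_ [dF _]]]] _] := H z zr; exact: is_derive_coord.
  - have [_ /(_ i)[H1 _]] := H z zr; exact: le_trans (mx_coord_le _ _) H1.
  - move=> j; have [_ /(_ i)[_ /(_ j) H2]] := H z zr; exact: le_trans (mx_coord_le _ _) H2.
split.
- apply: mx_norm_le; first by rewrite mulr_ge0// mulr_ge0// sqr_ge0.
  move=> k; have [_ + _] := T k; rewrite !mxE => /le_trans; apply.
  by rewrite ler_wpM2r.
- apply: mx_norm_le; first by rewrite !mulr_ge0// ?sqr_ge0.
  move=> k; have [_ _ +] := T k; rewrite !mxE /jac summxE.
  under [in X in _ -> X]eq_bigr do rewrite mxE mulrC; move=> /le_trans; apply.
  rewrite [leLHS](_ : _ = n%:R * n%:R * L * `|y - x| ^+ 2); last by ring.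
  by rewrite ler_wpM2r ?sqr_ge0// ler_wpM2r// expr2 ler_pM.
- move=> v; apply: mx_norm_le; first by rewrite !mulr_ge0// sqr_ge0.
  move=> k; have [T1 _ _] := T k; rewrite !mxE /jac !summxE -sumrB.
  under eq_bigr do rewrite !mxE -mulrBr.
  apply: le_trans (sum_coord_le (mx_coord_le v) T1) _.
  have v0 := normr_ge0 v; have yx := normr_ge0 (y - x).
  rewrite [leLHS](_ : _ = n%:R * n%:R * (L * `|y - x| * `|v|)); last by ring.
  rewrite [leRHS](_ : _ = n.+1%:R * n.+1%:R * (L * `|y - x| * `|v|)); last by ring.
  by rewrite ler_wpM2r ?mulr_ge0// ler_pM.
Qed.

Lemma C2_taylor_real (U : set V) (g : V -> R^o) (c : V) :
  C2_on U g -> U c -> exists r L : R, [/\ 0 < r, 0 <= L,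
    forall x, `|x - c| < r -> U x & forall x y, `|x - c| < r -> `|y - c| < r ->
     `|g y - g x| <= L * `|y - x| /\
     `|g y - g x - \sum_(i < n) 'D_(ebasis R i) g x * (y - x) ord0 i| <=
       L * `|y - x| ^+ 2].
Proof.
move=> C2g Uc; have [r [L [r0 L0 H]]] := C2_bounds C2g Uc.
have [_ Ug] := C2g.
have N1 : 1 <= n.+1%:R :> R by rewrite ler1n.
have nN : n%:R <= n.+1%:R :> R by rewrite ler_nat.
have L2 : n%:R * L <= n.+1%:R ^+ 2 * L.
  by rewrite ler_wpM2r// expr2 (le_trans nN)// ler_peMr.
exists r, (n.+1%:R ^+ 2 * L); split=> //; first by rewrite mulr_ge0// sqr_ge0.
  by move=> x /H[].
move=> x y xr yr.
have [||||_ H1 H2] := @taylor_scalar g (fun i => 'D_(ebasis R i) g)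
  (fun i j => 'D_(ebasis R j) ('D_(ebasis R i) g)) c r L _ _ _ _ x y xr yr.
- by move=> z zr i; have [/Ug[_ /(_ i i)[/derivableP]]] := H z zr.
- by move=> z zr i j; have [/Ug[_ /(_ i j)[_ [_ [/derivableP]]]]] := H z zr.
- by move=> z zr i; have [_ /(_ i)[]] := H z zr.
- by move=> z zr i j; have [_ /(_ i)[_ /(_ j)]] := H z zr.
split; first by apply: le_trans H1 _; rewrite ler_wpM2r.
apply: le_trans H2 _.
rewrite [leLHS](_ : _ = n%:R * n%:R * L * `|y - x| ^+ 2); last by ring.
by rewrite ler_wpM2r ?sqr_ge0// ler_wpM2r// expr2 ler_pM.
Qed.

End Calculus.

(** * Metric regularity *)

Section LevelSets.
Variables (R : realType) (n : nat).
Notation V := 'rV[R]_n.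
Implicit Types (x y z v : V).

(** Subtracting [t] times the remainder at [y] from the remainder at x + t (y - x) cancels the
    linear terms. The error keeps a factor [t], which lets [manifold_descent] divide by [t]. *)
Lemma chord_error (W : normedModType R) (G : V -> W) (J : V -> W) x y (t L : R) :
  0 <= t <= 1 -> 0 <= L -> J (t *: (y - x)) = t *: J (y - x) ->
  `|G (x + t *: (y - x)) - G x - J (t *: (y - x))| <= L * `|t *: (y - x)| ^+ 2 ->
  `|G y - G x - J (y - x)| <= L * `|y - x| ^+ 2 ->
  `|G (x + t *: (y - x)) - (G x + t *: (G y - G x))| <= 2 * L * t * `|y - x| ^+ 2.
Proof.
move=> /andP[t0 t1] L0 Jt H1 H2.
have -> : G (x + t *: (y - x)) - (G x + t *: (G y - G x)) =
   (G (x + t *: (y - x)) - G x - J (t *: (y - x))) - t *: (G y - G x - J (y - x)).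
  by rewrite Jt [X in _ = _ - X]scalerBr [in RHS]opprB subrKA opprD addrA.
apply: le_trans (ler_normB _ _) _.
rewrite normrZ ger0_norm//.
move: H1; rewrite normrZ ger0_norm// exprMn => H1.
have H3 : t * `|G y - G x - J (y - x)| <= t * (L * `|y - x| ^+ 2) by rewrite ler_wpM2l.
have H4 : L * (t ^+ 2 * `|y - x| ^+ 2) <= L * t * `|y - x| ^+ 2.
  by rewrite mulrA ler_wpM2r ?sqr_ge0// ler_wpM2l// expr2 ler_piMr.
lra.
Qed.

Lemma jac_sum m (F : V -> 'rV[R]_m) x k (a : 'I_k -> R) (v : 'I_k -> V) :
  jac F x (\sum_(j < k) a j *: v j) = \sum_(j < k) a j *: jac F x (v j).
Proof.
rewrite /jac; under [RHS]eq_bigr do rewrite scaler_sumr.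
rewrite exchange_big /=; apply: eq_bigr => i _.
rewrite summxE scaler_suml; apply: eq_bigr => j _.
by rewrite mxE scalerA.
Qed.

(** The difference quotient is within L |t| |v|^2 of [jac F c v]. *)
Lemma derive_jac m (F : V -> 'rV[R]_m) (c : V) (r L : R) : 0 < r -> 0 <= L ->
  (forall y, `|y - c| < r -> `|F y - F c - jac F c (y - c)| <= L * `|y - c| ^+ 2) ->
  forall v, 'D_v F c = jac F c v.
Proof.
move=> r0 L0 H v; apply: cvg_lim => //; apply/cvgrPdist_le => /= e e0.
have v1 : 0 < `|v| + 1 by rewrite ltr_wpDl.
near=> t.
have t0 : t != 0 by near: t; exact: nbhs_dnbhs_neq.
have tr : `|t| < r / (`|v| + 1) by near: t; apply: dnbhs0_lt; rewrite divr_gt0.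
have te : `|t| < e / (L * `|v| ^+ 2 + 1).
  by near: t; apply: dnbhs0_lt; rewrite divr_gt0// ltr_wpDl// mulr_ge0// sqr_ge0.
have E : t *: v + c - c = t *: v by rewrite addrK.
have := H (t *: v + c); rewrite E normrZ jacZ exprMn.
have -> : jac F c v - t^-1 *: (F (t *: v + c) - F c) =
    - (t^-1 *: (F (t *: v + c) - F c - t *: jac F c v)).
  by rewrite [in RHS]scalerBr [in RHS]scalerA mulVf// scale1r opprB.
rewrite normrN normrZ normfV => {}H.
have tp : 0 < `|t| by rewrite normr_gt0.
rewrite ler_pdivrMl//; apply: le_trans (H _) _.
  move: tr; rewrite ltr_pdivlMr//; apply: le_lt_trans.
  by rewrite ler_wpM2l// lerDl.
move: te; rewrite ltr_pdivlMr; last by rewrite ltr_wpDl// mulr_ge0// sqr_ge0.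
have := normr_ge0 v => v0 te.
rewrite expr2 mulrCA -mulrA; rewrite ler_wpM2l//; lra.
Unshelve. all: by end_near. Qed.

(** Preimages of the basis vectors, extended linearly; the added 1 keeps [K] positive even for
    [m = 0]. *)
Lemma jac_right_inverse m (F : V -> 'rV[R]_m) (c : V) :
  (forall w, exists v, jac F c v = w) -> exists B : 'rV[R]_m -> V, exists2 K : R, 0 < K &
    forall w, jac F c (B w) = w /\ `|B w| <= K * `|w|.
Proof.
move=> surj; have [v vP] := choice (fun k : 'I_m => surj (delta_mx ord0 k)).
exists (fun w => \sum_(k < m) w ord0 k *: v k), (\sum_(k < m) `|v k| + 1).
  by rewrite ltr_wpDl// sumr_ge0.
move=> w; split.
  by rewrite jac_sum [RHS]row_sum_delta; apply: eq_bigr => k _; rewrite vP.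
apply: le_trans (ler_norm_sum _ _ _) _.
rewrite mulrDl mul1r mulr_suml -[leLHS]addr0 lerD//.
apply: ler_sum => k _; rewrite normrZ mulrC ler_wpM2l//; exact: mx_coord_le.
Qed.

Lemma pos_le_inv (a : R) : 0 <= a -> exists2 t : R, 0 < t & a * t <= 1.
Proof.
move=> a0; exists (a + 1)^-1; first by rewrite invr_gt0; lra.
by rewrite ler_pdivrMr; lra.
Qed.

(* The minimiser of [|F z| + |z - z0| / (4 K)] over a small box is a zero of [F]:
   otherwise the approximate Newton direction [- B (F z)] would decrease it. *)
Lemma metric_regularity m (U : set V) (F : V -> 'rV[R]_m) (c : V) (r1 : R) :
  C2_on U F -> U c -> F c = 0 -> (forall w, exists v, 'D_v F c = w) -> 0 < r1 ->
  exists rho k : R, [/\ 0 < rho, 0 <= k & forall z0, `|z0 - c| < rho ->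
    exists z, [/\ U z, F z = 0, `|z - c| < r1 & `|z - z0| <= k * `|F z0|]].
Proof.
move=> C2F Uc Fc surj r10.
have [r [L [r0 L0 rU T]]] := C2_taylor C2F Uc.
have cr : `|c - c| < r by rewrite subrr normr0.
have Dj v : 'D_v F c = jac F c v.
  by apply: (@derive_jac _ _ _ r L) => // y yr; have [] := T c y cr yr.
have [|B [K K0 BP]] := @jac_right_inverse m F c.
  by move=> w; have [v vw] := surj w; exists v; rewrite -Dj.
(* Within [t] of [c], replacing the Jacobian at [z] by the one at [c] changes its value on the
   Newton direction by at most L t K |F z| <= |F z| / 2. *)
have [t t0 tP] : exists2 t : R, 0 < t & 2 * L * K * t <= 1.
  by apply: pos_le_inv; rewrite !mulr_ge0// ltW.
pose p := Num.min (Num.min r r1) t.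
have p0 : 0 < p by rewrite !lt_min r0 r10.
have [pr pr1 pt] : [/\ p <= r, p <= r1 & p <= t].
  by split; rewrite !ge_min lexx ?orbT.
have pP : 2 * L * K * p <= 1.
  by apply: le_trans tP; rewrite ler_wpM2l// !mulr_ge0// ltW.
(* A Newton step scaled by h has length at most h K |F z|, so it raises the distance penalty by at
   most h |F z| / 4. *)
pose a := (4 * K)^-1.
have a0 : 0 < a by rewrite invr_gt0 mulr_gt0.
have aK : a * K = 4^-1 by rewrite /a invfM -mulrA mulVf ?mulr1// gt_eqF.
(* The second bound gives |F z0| < a p / 4, which keeps the minimiser within p / 4 of [z0], inside
   the box of radius p / 2. *)
pose rho := Num.min (p / 2) (a * p / (4 * (L + 1))).
have L1 : 0 < L + 1 by lra.
have rho0 : 0 < rho by rewrite lt_min !divr_gt0// mulr_gt0.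
exists rho, (4 * K); split=> // [|z0]; first by rewrite mulr_ge0// ltW.
rewrite lt_min => /andP[z0p]; rewrite ltr_pdivlMr ?mulr_gt0// => z0a.
have z0r : `|z0 - c| < r by lra.
have Fz0 : `|F z0| < a * p / 4.
  have [+ _ _] := T c z0 cr z0r; rewrite Fc subr0.
  have := normr_ge0 (z0 - c); nra.
pose A : set V := [set z | `|z - z0| <= p / 2].
have Ap z : A z -> `|z - c| < p.
  move=> Az; have := ler_normD (z - z0) (z0 - c); rewrite subrKA.
  by move: Az; rewrite /A /=; lra.
pose phi (z : V) : R := `|F z| + a * `|z - z0|.
have [||| z Az zmin] := @EVT_min_rV R n phi A.
- by exists z0; rewrite /A /= subrr normr0; lra.
- exact: compact_box.
- apply: continuous_in_subspaceT => z /set_mem /Ap zp.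
  have [_ /(_ z (rU z (lt_le_trans zp pr)))[Fcont _]] := C2F.
  apply: (@cvgD _ _ _ (nbhs z)); first by apply: (@cvg_norm _ _ _ (nbhs z)).
  apply: (@cvgM _ _ (nbhs z)); first exact: cvg_cst.
  apply: (@cvg_norm _ _ _ (nbhs z)); apply: (@cvgB _ _ _ (nbhs z)) => //.
  exact: cvg_cst.
move: Az => /set_mem Az; have zp := Ap z Az.
have {}zmin y : A y -> phi z <= phi y by move=> /mem_set; exact: zmin.
have zr : `|z - c| < r by lra.
have := zmin z0; rewrite /A /phi /= subrr normr0 mulr0 addr0.
have Fz := normr_ge0 (F z).
move=> /(_ ltac:(lra)) zz0.
have az : a * `|z - z0| <= `|F z0| by lra.
have zz0p : `|z - z0| < p / 4.
  rewrite -(ltr_pM2l a0); lra.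
exists z; split; [exact: rU| |lra|]; last first.
  by rewrite -ler_pdivrMl ?mulr_gt0.
apply/eqP; rewrite -normr_eq0; apply/negPn/negP => Fz_neq0.
pose b := `|F z|; have b0 : 0 < b by rewrite lt0r Fz_neq0.
have [Bz1 Bz2] := BP (- F z); set v := B (- F z) in Bz1 Bz2.
rewrite normrN -/b in Bz2.
(* The three bounds allow the convex weight 1 - h, keep z + h v in the box, and make the quadratic
   remainder at most h b / 8; [L + 1] avoids division by zero. *)
pose h := Num.min 1 (Num.min (p / (4 * (K * b))) (8 * ((L + 1) * (K ^+ 2 * b)))^-1).
have Kb : 0 < K * b by rewrite mulr_gt0.
have K2b : 0 < K ^+ 2 * b by rewrite mulr_gt0// exprn_gt0.
have LK2b : 0 < (L + 1) * (K ^+ 2 * b) by rewrite mulr_gt0.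
have h0 : 0 < h.
  rewrite !lt_min ltr01/= invr_gt0; apply/andP; split; last by rewrite mulr_gt0.
  by rewrite divr_gt0// mulr_gt0.
have [h1 h2 h3] : [/\ h <= 1, h * (4 * (K * b)) <= p &
    h * (8 * ((L + 1) * (K ^+ 2 * b))) <= 1].
  split; first by rewrite ge_min lexx.
    by rewrite -ler_pdivlMr ?mulr_gt0// !ge_min lexx !orbT.
  by rewrite -ler_pdivlMr ?mulr_gt0// div1r !ge_min lexx !orbT.
have hv : `|h *: v| <= h * (K * b) by rewrite normrZ gtr0_norm// ler_pM2l.
have Ah : A (z + h *: v).
  rewrite /A /= addrAC; apply: le_trans (ler_normD _ _) _; lra.
have [_ T1 _] := T z (z + h *: v) zr (lt_le_trans (Ap _ Ah) pr).
have [_ _ T2] := T c z cr zr.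
move: (zmin (z + h *: v) Ah); apply/negP; rewrite -ltNge /phi.
have D1 : `|z + h *: v - z0| <= `|z - z0| + h * (K * b).
  by rewrite addrAC; apply: le_trans (ler_normD _ _) _; lra.
have D2 : `|F (z + h *: v)| <= (1 - h) * b + h * (b / 2) + L * (h * (K * b)) ^+ 2.
  rewrite (addrAC z) subrr add0r jacZ in T1.
  have -> : F (z + h *: v) = (1 - h) *: F z + h *: (jac F z v - jac F c v) +
      (F (z + h *: v) - F z - h *: jac F z v).
    rewrite Bz1; move: (F (z + h *: v)) (jac F z v) => u w.
    by apply/rowP => k; rewrite !mxE; ring.
  apply: le_trans (ler_normD _ _) _; apply: lerD.
    apply: le_trans (ler_normD _ _) _; apply: lerD.
      by rewrite normrZ ger0_norm//; lra.
    rewrite normrZ gtr0_norm// ler_pM2l//; apply: le_trans (T2 v) _.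
    have : L * `|z - c| * `|v| <= L * p * (K * b).
      by rewrite ler_pM ?mulr_ge0// ler_wpM2l// ltW.
    nra.
  apply: le_trans T1 _; rewrite ler_wpM2l// ler_sqr// nnegrE//.
  by rewrite mulr_ge0// ltW.
have D3 : a * `|z + h *: v - z0| <= a * `|z - z0| + h * b / 4.
  have : a * `|z + h *: v - z0| <= a * (`|z - z0| + h * (K * b)) by rewrite ler_pM2l.
  have -> : a * (`|z - z0| + h * (K * b)) = a * `|z - z0| + (a * K) * (h * b) by ring.
  rewrite aK; lra.
have D4 : L * (h * (K * b)) ^+ 2 <= h * b / 8.
  have -> : L * (h * (K * b)) ^+ 2 = (h * b) * (h * (L * (K ^+ 2 * b))) by ring.
  have hb : 0 < h * b by rewrite mulr_gt0.
  have : h * (L * (K ^+ 2 * b)) <= 1 / 8.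
    have : 0 < h * (K ^+ 2 * b) by rewrite mulr_gt0.
    nra.
  by move=> /(ler_wpM2l (ltW hb)); lra.
have hb : 0 < h * b by rewrite mulr_gt0.
(* Of the gain h b, at most h b / 2 is lost to freezing the Jacobian, h b / 8 to the remainder and h
   b / 4 to the penalty, so [phi] still drops. *)
rewrite -/b; lra.
Qed.

End LevelSets.

(** * Descent along the manifold *)

Section ErrorBounds.
Variables (R : realType) (n : nat).
Notation V := 'rV[R]_n.
Implicit Types (x y z v : V) (f : V -> \bar R) (M : set V).

Lemma partial_sumZ (G : V -> R^o) x v (t : R) :
  \sum_(i < n) 'D_(ebasis R i) G x * (t *: v) ord0 i =
  t *: (\sum_(i < n) 'D_(ebasis R i) G x * v ord0 i : R^o).
Proof. by rewrite scaler_sumr; apply: eq_bigr => i _; rewrite mxE; exact: mulrCA. Qed.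

(* Moving from [x] a fraction [t] of the way towards [y] and projecting back on
   [M] by metric regularity costs only [O(t |y - x|^2)]. *)
Lemma manifold_descent f M (c : V) m (U U' : set V) (F : V -> 'rV[R]_m) (g : V -> R^o) :
  M c -> U c -> C2_on U F -> (forall w, exists v, 'D_v F c = w) ->
  M `&` U = [set x | U x /\ F x = 0] ->
  U' c -> C2_on U' g -> (forall x, M x -> U' x -> f x = (g x)%:E) ->
  exists e C r : R, [/\ 0 < e, 0 < C, 0 < r & forall x y s,
    M x -> M y -> edist x c < e -> edist y c < e -> 0 < s ->
    (\forall z \near x, M z -> ((g x - s * edist z x)%:E <= f z)%E) ->
    g x - C * s * edist y x - r * edist y x ^+ 2 <= g y].
Proof.
move=> Mc Uc C2F surj MU U'c C2g fg.
have FM x : M x -> U x -> F x = 0.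
  by move=> Mx Ux; have : (M `&` U) x by []; rewrite MU => -[].
have [r1 [L1 [r10 L10 r1U T1]]] := C2_taylor C2F Uc.
have [r2 [L2 [r20 L20 r2U T2]]] := C2_taylor_real C2g U'c.
(* The projected point must land within [r2] of [c], where [g] can be expanded. *)
have [rho [k [rho0 k0 MR]]] := metric_regularity C2F Uc (FM c Mc Uc) surj r20.
(* As e <= t0 and |y - x| <= 2 e, the projection will move [z0] by at most t |y - x|. *)
have [t0 t00 t0P] : exists2 t : R, 0 < t & 4 * k * L1 * t <= 1.
  by apply: pos_le_inv; rewrite !mulr_ge0.
pose e := Num.min (Num.min r1 r2) (Num.min rho t0).
have e0 : 0 < e by rewrite !lt_min r10 r20 rho0.
have [er1 er2 erho et0] : [/\ e <= r1, e <= r2, e <= rho & e <= t0].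
  by split; rewrite !ge_min lexx ?orbT.
pose N : R := n.+1%:R; have N0 : 0 < N by rewrite ltr0n.
exists e, (2 * N), (2 * L2 + 2 * L1 * L2 * k + 1); split=> //.
- by rewrite mulr_gt0.
- by rewrite ltr_wpDl// addr_ge0// !mulr_ge0.
move=> x y s Mx My /(le_lt_trans (enorm_ge _)) xe /(le_lt_trans (enorm_ge _)) ye s0.
move=> /nearP[d d0 xd].
pose D := `|y - x|; have D0 : 0 <= D := normr_ge0 _.
have De : D <= 2 * e.
  have := ler_normD (y - c) (c - x); rewrite subrKA (distrC c) -/D; lra.
have Fx : F x = 0 by apply: FM => //; apply: r1U; lra.
have Fy : F y = 0 by apply: FM => //; apply: r1U; lra.
(* This brings the projected point within [d] of [x], where the lower bound holds; [D + 1] covers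
   the case y = x. *)
pose t := Num.min 1 (d / (4 * N * (D + 1))).
have ND : 0 < 4 * N * (D + 1) by rewrite !mulr_gt0//; lra.
have t0' : 0 < t by rewrite lt_min ltr01 divr_gt0.
have t1 : t <= 1 by rewrite ge_min lexx.
have td : t * (4 * N * (D + 1)) <= d by rewrite -ler_pdivlMr// ge_min lexx orbT.
pose z0 := x + t *: (y - x).
have z0c : `|z0 - c| < e.
  have -> : z0 - c = (1 - t) *: (x - c) + t *: (y - c).
    by apply/rowP => i; rewrite !mxE; ring.
  apply: le_lt_trans (ler_normD _ _) _; rewrite !normrZ !ger0_norm ?subr_ge0//; last exact: ltW.
  have := normr_ge0 (x - c); nra.
have z0x : z0 - x = t *: (y - x) by rewrite /z0 addrC addKr.
have tI : 0 <= t <= 1 by rewrite ltW.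
have xr1 : `|x - c| < r1 by lra.
have xr2 : `|x - c| < r2 by lra.
have yr1 : `|y - c| < r1 by lra.
have yr2 : `|y - c| < r2 by lra.
have z0r1 : `|z0 - c| < r1 by lra.
have z0r2 : `|z0 - c| < r2 by lra.
have F0 : `|F z0| <= 2 * L1 * t * D ^+ 2.
  have := @chord_error R n _ F (jac F x) x y t L1 tI L10 (jacZ F x _ t).
  have [_ + _] := T1 x z0 xr1 z0r1; rewrite z0x => H; move=> /(_ H).
  have [_ H2 _] := T1 x y xr1 yr1; move=> /(_ H2).
  by rewrite Fx Fy subrr scaler0 addr0 subr0.
have G0 : `|g z0 - (g x + t * (g y - g x))| <= 2 * L2 * t * D ^+ 2.
  have := @chord_error R n R^o g
    (fun v => \sum_(i < n) 'D_(ebasis R i) g x * v ord0 i) x y t L2 tI L20 (partial_sumZ g x _ t).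
  have [_ +] := T2 x z0 xr2 z0r2; rewrite z0x => H; move=> /(_ H).
  by have [_ H2] := T2 x y xr2 yr2; move=> /(_ H2).
have [z [Uz Fz zr2 zz0]] := MR z0 (lt_le_trans z0c erho).
have Mz : M z by have : (M `&` U) z by [rewrite MU]; case.
have {}zz0 : `|z - z0| <= k * (2 * L1 * t * D ^+ 2).
  by apply: le_trans zz0 _; rewrite ler_wpM2l.
have zz0' : `|z - z0| <= t * D.
  apply: le_trans zz0 _.
  have -> : k * (2 * L1 * t * D ^+ 2) = (t * D) * (2 * k * L1 * D) by ring.
  have tD : 0 <= t * D by rewrite mulr_ge0// ltW.
  rewrite ler_piMr//; apply: le_trans t0P.
  have kL : 0 <= k * L1 by rewrite mulr_ge0.
  nra.
have zx : `|z - x| <= 2 * t * D.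
  have := ler_normD (z - z0) (z0 - x); rewrite subrKA z0x normrZ gtr0_norm//.
  rewrite -/D; lra.
have zxE : edist z x <= 2 * N * t * D.
  apply: le_trans (enorm_le _) _; rewrite -/N.
  have -> : 2 * N * t * D = N * (2 * t * D) by ring.
  by rewrite ler_pM2l.
have Nt : 0 < N * t by rewrite mulr_gt0.
have zd : edist z x < d by apply: le_lt_trans zxE (lt_le_trans _ td); nra.
have := xd z zd Mz; rewrite (fg z Mz (r2U z zr2)) lee_fin => gz.
have [gz0 _] := T2 z0 z z0r2 zr2.
have gz0' : g z - g z0 <= L2 * (k * (2 * L1 * t * D ^+ 2)).
  by apply: le_trans (ler_norm _) (le_trans gz0 _); rewrite ler_wpM2l.
have sz : s * edist z x <= s * (2 * N * t * D) by rewrite ler_pM2l.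
move: G0; rewrite ler_norml => /andP[_ G0].
(* Chain the lower bound at [z], the Lipschitz bound between [z] and [z0], and the chord bound at
   [z0]: apart from [g x], which cancels, every term carries a factor [t], which is divided out. *)
have key : g x - 2 * N * s * D - (2 * L2 + 2 * L1 * L2 * k) * D ^+ 2 <= g y.
  rewrite -(ler_pM2l t0'); lra.
have DE : D <= edist y x := enorm_ge _.
have E0 := edist_ge0 y x.
have D2 : D ^+ 2 <= edist y x ^+ 2 by rewrite ler_sqr.
have q0 : 0 <= 2 * L2 + 2 * L1 * L2 * k by rewrite addr_ge0// !mulr_ge0.
have h1 := ler_wpM2l q0 D2.
have h2 : 2 * N * s * D <= 2 * N * s * edist y x.
  by rewrite ler_wpM2l// !mulr_ge0// ltW.
have h3 : 0 <= edist y x ^+ 2 by rewrite sqr_ge0.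
lra.
Qed.

(** Near [c], [M] is the zero set of a continuous map, and not vanishing is an open condition. *)
Lemma submanifold_locally_closed M (c : V) : M c -> C2_submanifold_around M c ->
  exists2 d : R, 0 < d & forall x, edist x c < d -> ~ M x -> \forall y \near x, ~ M y.
Proof.
move=> Mc [m [U [F [Uc [[oU UF] [_ MU]]]]]].
have [d d0 dU] := nearP (open_nbhs_nbhs (conj oU Uc)).
exists d => // x /dU Ux nMx.
have Fx : F x != 0.
  apply/eqP => Fx0; apply: nMx.
  by have : (M `&` U) x by [rewrite MU]; case.
have [Fc _] := UF x Ux.
have Fx0 : 0 < `|F x| by rewrite normr_gt0.
have Fnear := continuous_near_dist Fc Fx0.
have Unear := open_nbhs_nbhs (conj oU Ux).
apply: (@filterS _ (nbhs x) _ _ _ _ (filterI Fnear Unear)) => y [/= Fy Uy] My.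
have : (M `&` U) y by []; rewrite MU => -[_ Fy0].
by move: Fy; rewrite Fy0 subr0 ltxx.
Qed.

(** * Distance to a set and comparison of slopes *)

Lemma setdist_le_edist x (S : set V) y : S y -> (setdist x S <= (edist x y)%:E)%E.
Proof. by move=> Sy; apply: ereal_inf_lbound; exists y. Qed.

Lemma setdist_ge0 x (S : set V) : (0 <= setdist x S)%E.
Proof. by apply: le_ereal_inf_tmp => _ [y _ <-]; rewrite lee_fin edist_ge0. Qed.

Lemma setdist_mono x (S S' : set V) : S `<=` S' -> (setdist x S' <= setdist x S)%E.
Proof. by move=> SS'; apply: ereal_inf_le_tmp; exact: image_subset. Qed.

(** A point of [S] at distance at least [e] from [c] is farther from [x] than [c] is, so only points
    of [S] near [c] matter, and these lie in [M]. *)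
Lemma setdist_local x (S M : set V) (c : V) (e : R) : S c -> M c ->
  edist x c < e / 2 -> (forall y, S y -> edist y c < e -> M y) ->
  (setdist x (S `&` M) <= setdist x S)%E.
Proof.
move=> Sc Mc xc SM; apply: le_ereal_inf_tmp => _ [y Sy <-].
have [ye|ey] := ltP (edist y c) e.
  by apply: setdist_le_edist; split=> //; exact: SM.
apply: le_trans (setdist_le_edist x (conj Sc Mc)) _; rewrite lee_fin.
have := edist_triangle x y c; rewrite (edistC y x); lra.
Qed.

(** Reduces a bound by a slope to real numbers slightly above it, the form in which [slope_lt]
    applies, while keeping them below the threshold [s0]. *)
Lemma le_slope_of_forall (X A : \bar R) (s0 : R) : (A < s0%:E)%E ->
  (0 <= A)%E -> (forall s : R, 0 < s -> s < s0 -> (A < s%:E)%E -> (X <= s%:E)%E) ->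
  (X <= A)%E.
Proof.
case: A => [a| |]//; rewrite lte_fin lee_fin => as0 a0 H.
apply/lee_addgt0Pr => e e0; pose s := Num.min (a + e) ((a + s0) / 2).
have [sa se ss] : [/\ a < s, s <= a + e & s < s0].
  rewrite lt_min gt_min ge_min lexx; split=> //; first by apply/andP; split; lra.
  by apply/orP; right; lra.
by apply: le_trans (H s _ ss _) _; rewrite ?lte_fin ?lee_fin//; lra.
Qed.

(** A point that is not a local minimiser has lower values arbitrarily close to it, so every
    supremum of quotients is nonnegative. *)
Lemma slope_ge0 (M : set V) f x : (forall y, f y != -oo%E) -> M x -> (0 <= slope_on M f x)%E.
Proof.
move=> fN Mx; rewrite /slope_on.
case: (pselect (dom f x)) => [fd|fd] /=; last exact: leey.
case: pselect => //= nlm.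
apply: le_ereal_inf_tmp => _ [e /= e0 <-].
have [y [My yx fyx]] : exists y, [/\ M y, edist y x < e & (f y < f x)%E].
  apply: contrapT => H; apply: nlm; split=> //; exists e => // y My yx.
  by rewrite leNgt; apply/negP => fyx; apply: H; exists y.
have yNx : y != x by apply: contraTneq fyx => ->; rewrite ltxx.
apply: le_trans (_ : 0 <= (f x - f y) * (edist x y)^-1%:E)%E _.
  apply: mule_ge0; last by rewrite lee_fin invr_ge0 edist_ge0.
  rewrite sube_ge0 ?ltW//; apply/orP; left.
  by rewrite fin_numE fN/= (lt_eqF (lt_le_trans fyx (leey _))).
by apply: ereal_sup_ubound; exists y => //; rewrite /= edistC.
Qed.

Lemma setdist_fin x y (S : set V) : S y ->
  exists2 t : R, setdist x S = t%:E & 0 <= t <= edist x y.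
Proof.
move=> Sy; have := setdist_le_edist x Sy; have := setdist_ge0 x S.
case: (setdist x S) => [t| |]//; rewrite !lee_fin => t0 ty.
by exists t => //; apply/andP.
Qed.

Lemma slope_on_le_slope f M x (s0 : R) : (forall y, f y != -oo%E) ->
  (slope f x < s0%:E)%E -> (slope_on M f x <= slope f x)%E.
Proof.
move=> fN sx; apply: (le_slope_of_forall sx); first exact: slope_ge0.
move=> s sp _ /(slope_lt fN sp)[a fx fnear].
apply: (slope_le fx (ltW sp)); apply: filterS fnear => y Hy _; exact: Hy.
Qed.

(** Extends the lower bound along [M] to a whole box: the penalty is so flat there that [memA] puts
    its minimiser on [M]. *)
Lemma quadratic_lower_bound_off_manifold f M x xb (b a C r s q eA sA : R) :
  closed_fun f -> f xb = b%:E -> argmin f xb -> f x = a%:E ->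
  0 < q -> 0 < r -> 0 < C -> 0 < s ->
  a - b < 2 * r * q ^+ 2 -> C * s + 6 * r * q <= sA -> edist x xb + q <= eA ->
  (forall y c, edist y xb < eA -> f y = c%:E ->
    (\forall w \near y, ((c - sA * edist w y)%:E <= f w)%E) -> M y) ->
  (forall z c, M z -> f z = c%:E -> edist z x < q ->
    a - C * s * edist z x - r * edist z x ^+ 2 <= c) ->
  forall y, `|y - x| <= q -> ((a - (C * s * edist y x + 2 * r * edist y x ^+ 2))%:E <= f y)%E.
Proof.
move=> cf fxb mxb fx q0 r0 C0 s0 abq Csq xq memA desc.
have [z [c [zq fz zmin]]] := @penalized_min R n f x a (C * s) (2 * r) q cf fx (ltW q0).
have ez0 := edist_ge0 z x; set ez := edist z x in ez0 zmin.
have Cs0 : 0 < C * s by rewrite mulr_gt0.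
have zx : c + C * s * ez + 2 * r * ez ^+ 2 <= a.
  have := zmin x; rewrite subrr normr0 edistxx fx lee_fin => /(_ (ltW q0)).
  by rewrite expr0n /= !mulr0 addr0 subr0.
have bc : b <= c by have := mxb z; rewrite fxb fz lee_fin.
have Cez : 0 <= C * s * ez by rewrite mulr_ge0// ltW.
(* As [b] is the minimum of [f], 2 r |z - x|^2 <= a - b < 2 r q^2, so a neighbourhood of [z] lies in
   the box. *)
have ezq : ez < q.
  have : 2 * r * ez ^+ 2 < 2 * r * q ^+ 2 by lra.
  by rewrite ltr_pM2l ?mulr_gt0// ltr_sqr// nnegrE ltW.
have Mz : M z.
  apply: (memA z c) => //; first by have := edist_triangle x z xb; rewrite -/ez; lra.
  have qz : 0 < q - ez by lra.
  have := near_edist z qz; apply: filterS => y yz.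
  have tri := edist_triangle z y x; rewrite -/ez in tri.
  have ey0 := edist_ge0 y x; have eyz := edist_ge0 y z.
  have yq : `|y - x| <= q by apply: le_trans (enorm_ge _) _; rewrite -/(edist y x); lra.
  apply: le_trans (zmin y yq); rewrite lee_fin.
  have h1 : C * s * edist y x <= C * s * (edist y z + ez) by rewrite ler_pM2l.
  have h2 : edist y x ^+ 2 <= (edist y z + ez) ^+ 2 by rewrite ler_sqr// nnegrE; lra.
  have h3 : 2 * r * edist y x ^+ 2 <= 2 * r * (edist y z + ez) ^+ 2.
    by rewrite ler_pM2l// mulr_gt0.
  (* Here |y - z| + 2 |z - x| < 3 q, so the penalty grows away from [z] at rate at most C s + 6 r q
     <= sA. *)
  have h4 : edist y z * (C * s + 2 * r * (edist y z + 2 * ez)) <= edist y z * sA.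
    rewrite ler_wpM2l//; have : r * (edist y z + 2 * ez) <= r * (3 * q).
      by rewrite ler_pM2l//; lra.
    lra.
  have -> : c + C * s * ez + 2 * r * ez ^+ 2 - (C * s * edist y x + 2 * r * edist y x ^+ 2)
    = c + (C * s * ez + 2 * r * ez ^+ 2 - (C * s * edist y x + 2 * r * edist y x ^+ 2)) by ring.
  have h5 : 2 * r * (edist y z + ez) ^+ 2 = 2 * r * ez ^+ 2 +
     edist y z * (2 * r * (edist y z + 2 * ez)) by ring.
  lra.
have := desc z c Mz fz ezq; rewrite -/ez => dz.
(* Minimality demands a drop of 2 r |z - x|^2 beyond the linear term, while descent along [M] allows
   only r |z - x|^2. *)
have ez00 : ez = 0.
  apply/eqP; rewrite eq_le ez0 andbT leNgt; apply/negP => ezp.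
  have : 0 < r * ez ^+ 2 by rewrite mulr_gt0// exprn_gt0.
  lra.
have zxE : z = x.
  by apply/eqP; rewrite -subr_eq0; apply/eqP/enorm_eq0.
move: fz; rewrite zxE fx => -[ac] y yq.
by have := zmin y yq; rewrite ez00 expr0n /= !mulr0 !addr0 -ac.
Qed.

End ErrorBounds.

Theorem theorem2 (R : realType) (n : nat) (f : 'rV[R]_n -> \bar R)
  (M : set 'rV[R]_n) (xb : 'rV[R]_n) :
  closed_fun f -> subdiff_continuous f ->
  argmin f !=set0 -> argmin f xb ->
  M xb -> identifiable_manifold f M xb ->
  (exists eps mu : R, 0 < eps /\ 0 < mu /\
     forall x, eball xb eps x ->
       (mu%:E * setdist x (argmin f) <= slope f x)%E)
  <->
  (exists eps mu : R, 0 < eps /\ 0 < mu /\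
     forall x, eball xb eps x -> M x ->
       (mu%:E * setdist x (argmin f `&` M) <= slope_on M f x)%E).
Proof.
move=> cf sc _ mxb Mxb [dxb [f0 [_ [[eta eta0 [delta delta0 sharp]] [sub restr]]]]].
have fN := cf.1.
have [b fxb] : exists b, f xb = b%:E.
  by move: dxb; rewrite /dom /=; case: (f xb) (fN xb) => [b| |]//; exists b.
have [d d0 Mcl] := submanifold_locally_closed Mxb sub.
have [eA [sA [eA0 sA0 memA]]] := small_slope_mem cf sc f0 d0 eta0 delta0 Mcl sharp.
(* A minimiser satisfies the lower bound with no loss, so near [xb] it lies on [M]. *)
have minM y : argmin f y -> edist y xb < eA -> M y.
  move=> my yA; have fy : f y = b%:E.
    by apply/eqP; rewrite eq_le -fxb; apply/andP; split; [exact: my|exact: mxb].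
  apply: (memA y b) => //; apply: filterE => z.
  apply: le_trans (my z); rewrite fy lee_fin gerBl.
  by rewrite mulr_ge0 ?edist_ge0// ltW.
split=> [[e [mu [e0 [mu0 EB]]]]|[e [mu [e0 [mu0 EB]]]]]; last first.
  pose ep := Num.min e eA.
  have ep0 : 0 < ep by rewrite lt_min e0.
  (* From (ii) to (i): where the slope is at least [sA], the rate [sA / ep] suffices because the
     distance to the minimisers is at most [ep]. *)
  pose nu := Num.min mu (sA / ep).
  have nu0 : 0 < nu by rewrite lt_min mu0 divr_gt0.
  exists ep, nu; do 2?split=> //; move=> x; rewrite /eball /= lt_min => /andP[xe xA].
  have [t tE /andP[t0 tx]] := setdist_fin x mxb.
  have [sx|sx] := ltP (slope f x) sA%:E; last first.
    apply: le_trans sx; rewrite tE lee_fin.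
    apply: (@le_trans _ _ (sA / ep * ep)); last by rewrite divfK ?gt_eqF.
    have tep : t <= ep by rewrite le_min; apply/andP; split; lra.
    by rewrite ler_pM// ?(ltW nu0)// ge_min lexx orbT.
  have Mx : M x.
    have [a fx xnear] := slope_lt fN sA0 sx.
    apply: (memA x a) => //; apply: filterS xnear => y; exact.
  apply: le_trans (slope_on_le_slope M fN sx).
  apply: le_trans (EB x xe Mx).
  apply: (@le_trans _ _ (mu%:E * setdist x (argmin f))%E).
    by rewrite tE lee_fin ler_wpM2r// ge_min lexx.
  by apply: lee_wpmul2l; [rewrite lee_fin ltW|apply: setdist_mono => y []].
have [m [U [F [Uxb [C2F [surj MU]]]]]] := sub.
have [U' [g [U'xb [C2g fg]]]] := restr.
have [eK [C [r [eK0 C0 r0 desc]]]] :=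
  manifold_descent Mxb Uxb C2F (surj xb Uxb) MU U'xb C2g fg.
have [dU dU0 dUP] := nearP (open_nbhs_nbhs (conj C2g.1 U'xb)).
(* The halves keep points within [q] of [x] in the required balls around [xb]. The last bound gives
   6 r q <= sA / 2, leaving the other half of [sA] for C s, which [s1] below ensures. *)
pose q := Num.min (Num.min (eK / 2) (eA / 2)) (Num.min (dU / 2) (sA / (12 * r))).
have q0 : 0 < q by rewrite !lt_min !divr_gt0// mulr_gt0.
have [qK qA qU qs] : [/\ q <= eK / 2, q <= eA / 2, q <= dU / 2 & q * (12 * r) <= sA].
  have : q <= sA / (12 * r) by rewrite !ge_min lexx !orbT.
  rewrite ler_pdivlMr ?mulr_gt0// => qs.
  by split=> //; rewrite !ge_min lexx ?orbT.
have v0 : 0 < 2 * r * q ^+ 2 by rewrite !mulr_gt0// exprn_gt0.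
(* Continuity of [g] will provide a - b < 2 r q^2. *)
have [dg dg0 dgP] := nearP (continuous_near_dist (C2g.2 xb U'xb).1 v0).
pose ep := Num.min (Num.min e q) dg.
have ep0 : 0 < ep by rewrite lt_min dg0 andbT lt_min e0 q0.
have [epe epq epg] : [/\ ep <= e, ep <= q & ep <= dg].
  have epeq : ep <= Num.min e q by rewrite ge_min lexx.
  by move: epeq; rewrite le_min => /andP[? ?]; split=> //; rewrite ge_min lexx orbT.
pose s1 := sA / (2 * C).
have s10 : 0 < s1 by rewrite divr_gt0// mulr_gt0.
(* The slope of [f] will be at most (C + 1) s, hence the first entry; the second handles slopes of
   at least [s1]. *)
pose nu := Num.min (mu / (C + 1)) (s1 / ep).
have C1 : 0 < C + 1 by lra.
have nu0 : 0 < nu by rewrite lt_min; apply/andP; split; apply: divr_gt0.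
exists ep, nu; do 2?split=> //; move=> x; rewrite /eball /= => xe Mx.
have [t tE /andP[t0 tx]] := setdist_fin x (conj mxb Mxb : (argmin f `&` M) xb).
have [sx|sx] := ltP (slope_on M f x) s1%:E; last first.
  apply: le_trans sx; rewrite tE lee_fin.
  apply: (@le_trans _ _ (s1 / ep * ep)); last by rewrite divfK ?gt_eqF.
  by rewrite ler_pM// ?(ltW nu0)// ?ge_min ?lexx ?orbT//; lra.
apply: (le_slope_of_forall sx); first exact: slope_ge0.
move=> s s0 ss1 /(slope_lt fN s0)[a fx xnear].
have U'x : U' x by apply: dUP; lra.
have ga : g x = a by have := fg x Mx U'x; rewrite fx => -[].
have gb : g xb = b by have := fg xb Mxb U'xb; rewrite fxb => -[].
have abq : a - b < 2 * r * q ^+ 2.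
  have := dgP x (lt_le_trans xe epg); rewrite ga gb ltr_norml; lra.
have Cs : C * s <= sA / 2.
  move: (ltW ss1); rewrite /s1 ler_pdivlMr ?mulr_gt0//; lra.
have sl : (slope f x <= ((C + 1) * s)%:E)%E.
  apply: (slope_le fx); first by rewrite mulr_ge0// ltW.
  (* Within s / (2 r) of [x] the term 2 r |y - x|^2 is at most s |y - x|, which turns C into C +
     1. *)
  have s2r : 0 < s / (2 * r) by rewrite divr_gt0// mulr_gt0.
  apply: (@filterS _ (nbhs x) _ _ _ _ (filterI (near_edist x q0) (near_edist x s2r))).
  move=> y [/= yq ys] _.
  have yq' : `|y - x| <= q by apply/ltW; apply: le_lt_trans (enorm_ge _) yq.
  have := @quadratic_lower_bound_off_manifold R n f M x xb b a C r s q eA sA cf fxb mxb fx q0 r0 C0 s0 abq.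
  move=> /(_ _ _ memA _ y yq') H; apply: le_trans (H _ _ _); last 1 first.
  - move=> z c Mz fz zq; have zxb := edist_triangle x z xb.
    have U'z : U' z by apply: dUP; lra.
    have gc : g z = c by have := fg z Mz U'z; rewrite fz => -[].
    rewrite -ga -gc; apply: desc => //; [lra|lra|].
    by rewrite ga.
  - rewrite lee_fin; move: ys; rewrite ltr_pdivlMr ?mulr_gt0// => ys.
    have ey0 := edist_ge0 y x; rewrite expr2; nra.
  - lra.
  - lra.
have := le_trans (EB x (lt_le_trans xe epe)) sl.
have := @setdist_local R n x (argmin f) M xb eA mxb Mxb _ minM.
rewrite tE => /(_ ltac:(lra)).
have [t' -> _] := setdist_fin x mxb; rewrite !lee_fin => tt' mt'.
apply: (@le_trans _ _ (mu / (C + 1) * t)).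
  by rewrite ler_wpM2r// ge_min lexx.
rewrite mulrAC ler_pdivrMr//.
have : mu * t <= mu * t' by rewrite ler_pM2l.
lra.
Qed.
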